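(* Fix the data-generating process $G(\theta,U_1)$ and the data-release mechanism $M(x,U_2)$. For any Pufferfish instantiation $(\epsilon,\mathbb D,\mathbb S)$ with privacy loss budget $0\le\epsilon<\infty$, the following statements are equivalent: (I) $M$ satisfies the Pufferfish instantiation $(\epsilon,\mathbb D,\mathbb S)$. (II) For all $S\in\mathscr F$, all competing conjectures $(E,E')\in\mathbb S$ and all attackers $\theta^*\in\mathbb D$ such that $P_{\theta^*}(X\in\cdot\mid X\in E)$ and $P_{\theta^*}(X\in\cdot\mid X\in E')$ are both well-defined, $$P(T\in S\mid\theta^*,X\in E)\le e^{\epsilon}P(T\in S\mid\theta^*,X\in E'),\qquad P(T\in S\mid\theta^*,X\in E')\le e^{\epsilon}P(T\in S\mid\theta^*,X\in E).$$ (III) For all $\delta\in\mathbb N$ and all $\theta,\theta'\in\Theta$ with $d_{\mathbb D,\mathbb S}(\theta,\theta')=\delta$, $P(T\in\cdot\mid\theta')\in\mathcal I_1(L_{\theta,\delta\epsilon},U_{\theta,\delta\epsilon})$, where $L_{\theta,\delta\epsilon}=e^{-\delta\epsilon}P(T\in\cdot\mid\theta)$ and $U_{\theta,\delta\epsilon}=e^{\delta\epsilon}P(T\in\cdot\mid\theta)$. (IV) For all $\theta\in\Theta$ and all measures $\nu\in\Omega$, if $P(T\in\cdot\mid\theta)$ has a density $p(t\mid\theta)$ with respect to $\nu$, then for every $\theta'\in\Theta$ with $d_{\mathbb D,\mathbb S}(\theta,\theta')<\infty$, $P(T\in\cdot\mid\theta')$ also has a density $p(t\mid\theta')$ with respect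 to $\nu$ satisfying $$e^{-\epsilon d_{\mathbb D,\mathbb S}(\theta,\theta')}p(t\mid\theta)\le p(t\mid\theta')\le e^{\epsilon d_{\mathbb D,\mathbb S}(\theta,\theta')}p(t\mid\theta)\quad\text{for all }t\in\mathcal T.$$
   Context: $(\mathcal X,\mathscr G)$ (data universe) and $(\mathcal T,\mathscr F)$ are measurable spaces, and $\Theta$ is in one-to-one correspondence $\theta\leftrightarrow P_\theta$ with the set of all probability measures on $(\mathcal X,\mathscr G)$. The data-generating process is a map $G:\Theta\times[0,1]\to\mathcal X$ with $G(\theta,\cdot)$ measurable for each $\theta$ and $P_\theta(X\in E)=\lambda(\{u_1\in[0,1]:G(\theta,u_1)\in E\})$ for $E\in\mathscr G$ ($X=G(\theta,U_1)$, $\lambda$ Lebesgue measure). A data-release mechanism is a $(\mathscr G\otimes\mathcal B[0,1],\mathscr F)$-measurable $M:\mathcal X\times[0,1]\to\mathcal T$; $P_x(S)=\lambda(\{u\in[0,1]:M(x,u)\in S\})$. The data-provision procedure outputs $T=M(G(\theta,U_1),U_2)$ with $U_1,U_2$ i.i.d. $\mathrm{Unif}[0,1]$, and $P(T\in S\mid\theta)=\int_{\mathcal X}P_x(S)\,dP_\theta(x)$. For $\theta\in\Theta$ and $E\in\mathscr G$ for which the conditional distribution $P_\theta(X\in\cdot\mid X\in E)$ is well-defined, $\theta|_E\in\Theta$ is the unique parameter with $P_{\theta|_E}(X\in\cdot)=P_\theta(X\in\cdot\mid X\in E)$, and $P(T\in\cdot\mid\theta,X\in E)=P(T\in\cdot\mid\theta|_E)$.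 (If $P_\theta(X\in E)>0$, this is the elementary conditional probability; if $X=(Y,Z)$ has a canonical density $f(y,z)$ with respect to a product measure $\mu_1\times\mu_2$ and $\{X\in E\}=\{Z=z_E\}$, it is the regular conditional probability with $\mu_1$-density $f(y,z_E)/\int f(y',z_E)\,d\mu_1(y')$ if the denominator is positive, and an arbitrary fixed $\mu_1$-density otherwise.) Only pairs for which these conditionals are well-defined are considered. A Pufferfish instantiation $(\epsilon,\mathbb D,\mathbb S)$ consists of a set $\mathbb D\subset\Theta$ (attackers), a set $\mathbb S\subset\mathscr G\times\mathscr G$ (pairs of competing conjectures) and $0\le\epsilon\le\infty$ (privacy loss budget). Let $G_{\mathbb D,\mathbb S}$ be the (undirected) graph on $\Theta$ with an edge $(\theta,\theta')$ whenever there exist $\theta^*\in\mathbb D$ and $(E,E')\in\mathbb S$ with $\theta=\theta^*|_E$ and $\theta'=\theta^*|_{E'}$; $d_{\mathbb D,\mathbb S}(\theta,\theta')\in\{0,1,2,\ldots,\infty\}$ is the length of a shortest path in this graph ($\infty$ if there is none). With $d_{\mathrm{Mult}}(\mu,\nu)=\sup_{S\in\mathscr F}|\ln(\mu(S)/\nu(S))|$ ($0/0=\infty/\infty=1$), $M$ satisfies the instantiation $(\epsilon,\mathbb D,\mathbb S)$ if $d_{\mathrm{Mult}}(P(T\in\cdot\mid\theta),P(T\in\cdot\mid\theta'))\le\epsilon\,d_{\mathbb D,\mathbb S}(\theta,\theta')$ for all $\theta,\theta'\in\Theta$, where $0\times\infty=\infty$. $\Omega$ is the set of $\sigma$-finite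 measures on $(\mathcal T,\mathscr F)$; for measures $L\le U$ (setwise), $\mathcal I_1(L,U)$ is the set of probability measures $P$ on $(\mathcal T,\mathscr F)$ with $L(S)\le P(S)\le U(S)$ for all $S\in\mathscr F$. *)

(* Defs.v *)
From HB Require Import structures.
From mathcomp Require Import all_boot all_order all_algebra.
From mathcomp Require Import all_classical all_reals all_analysis.
From mathcomp Require Import measurable_realfun.

Set Implicit Arguments.
Unset Strict Implicit.
Unset Printing Implicit Defensive.

Import Order.TTheory GRing.Theory Num.Theory.
Import numFieldNormedType.Exports.
Local Open Scope classical_set_scope.
Local Open Scope ring_scope.
Local Open Scope ereal_scope.

Definition is_density d (T : measurableType d) (R : realType)
    (nu : {measure set T -> \bar R}) (P : set T -> \bar R) (p : T -> R) :=
  [/\ measurable_fun setT p, (forall t, (0 <= p t)%R) &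
      forall S, measurable S -> P S = \int[nu]_(t in S) (p t)%:E].

(* Equality of measures is only required on measurable sets: a [probability]
   is a function on all subsets whose values elsewhere are irrelevant. *)
Record parametrization d (X : measurableType d) (R : realType) := {
  param :> Type;
  law : param -> probability X R;
  law_inj : forall t1 t2,
    (forall E, measurable E -> law t1 E = law t2 E) -> t1 = t2;
  law_surj : forall P : probability X R,
    exists t, forall E, measurable E -> law t E = P E }.

Section param_of.
Context d (X : measurableType d) (R : realType) (Theta : parametrization X R).

Definition param_of (P : probability X R) : Theta :=
  projT1 (cid (law_surj Theta P)).

Lemma law_param_of (P : probability X R) E :
  measurable E -> law (param_of P) E = P E.
Proof. by move=> mE; rewrite /param_of; case: cid => t /= ->. Qed.

End param_of.

(* Only the restriction of [mech] to X * [0, 1] matters. *)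
Record mechanism d d' (X : measurableType d) (T : measurableType d')
    (R : realType) := {
  mech :> X * R -> T;
  measurable_mech : measurable_fun (setT `*` (`[0%R, 1%R] : set R)) mech }.

Section release_law.
Context d d' (X : measurableType d) (T : measurableType d') (R : realType).
Variable M : mechanism X T R.

Definition output_law (x : X) (S : set T) : \bar R :=
  lebesgue_measure [set u : R | `[0%R, 1%R]%classic u /\ S (M (x, u))].

Let output_lawE S : output_law^~ S = lebesgue_measure \o
  xsection ((setT `*` (`[0%R, 1%R] : set R)) `&` M @^-1` S).
Proof.
apply/funext => x; rewrite /output_law /=; congr lebesgue_measure.
apply/seteqP; split => u /=; rewrite xsectionE /=; first by case.
by move=> [[_ ?] ?].
Qed.

Let measurable_graph S : measurable S ->
  measurable ((setT `*` (`[0%R, 1%R] : set R)) `&` M @^-1` S).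
Proof. by move=> mS; apply: measurable_mech => //; exact: measurableX. Qed.

Lemma measurable_output_law S : measurable S ->
  measurable_fun setT (output_law^~ S).
Proof.
move=> mS; rewrite output_lawE.
by apply: measurable_fun_xsection; exact: measurable_graph.
Qed.

Lemma output_law_ge0 x S : 0 <= output_law x S.
Proof. exact: measure_ge0. Qed.

Lemma output_law_bigcup x (F : (set T)^nat) :
  (forall n, measurable (F n)) -> trivIset setT F ->
  output_law x (\bigcup_n F n) = \sum_(n <oo) output_law x (F n).
Proof.
move=> mF tF; rewrite /output_law.
have mG n : measurable [set u : R | `[0%R, 1%R]%classic u /\ F n (M (x, u))].
  have := measurable_xsection x (measurable_graph (mF n)).
  rewrite xsectionE (_ : _ @^-1` _ =
    [set u : R | `[0%R, 1%R]%classic u /\ F n (M (x, u))])//.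
  by apply/seteqP; split => u /=; [move=> [[_ ?] ?]|case].
rewrite (_ : [set u : R | _] =
  \bigcup_n [set u : R | `[0%R, 1%R]%classic u /\ F n (M (x, u))]).
  rewrite measure_semi_bigcup//.
  - apply/trivIsetP => i j _ _ ij; apply/seteqP; split => // u /= [[_ Fi] [_ Fj]].
    suff: (F i `&` F j) (M (x, u)) by move/trivIsetP : tF => ->.
    by split.
  - by apply: bigcup_measurable => n _; exact: mG.
by apply/seteqP; split => u /= [?]; [move=> [n _ ?]; exists n|move=> _ [? ?];
  split => //; eexists; last eassumption].
Qed.

Definition release_law (P : probability X R) (S : set T) : \bar R :=
  \int[P]_x output_law x S.

Variable P : probability X R.

Let release_law0 : release_law P set0 = 0.
Proof.
apply: integral0_eq => x _; rewrite /output_law (_ : [set _ | _] = set0) ?measure0//.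
by apply/seteqP; split => // u [].
Qed.

Let release_law_ge0 S : 0 <= release_law P S.
Proof. by apply: integral_ge0 => x _; exact: output_law_ge0. Qed.

Let release_law_sigma_additive : semi_sigma_additive (release_law P).
Proof.
move=> F mF tF mUF; rewrite [X in _ --> X](_ : _ =
    \sum_(n <oo) release_law P (F n)).
  by apply: is_cvg_ereal_nneg_natsum_cond => n _ _; exact: release_law_ge0.
rewrite /release_law -integral_nneseries//.
- by apply: eq_integral => x _; exact: output_law_bigcup.
- by move=> n; exact: measurable_output_law.
Qed.

HB.instance Definition _ := isMeasure.Build _ _ _ (release_law P)
  release_law0 release_law_ge0 release_law_sigma_additive.

Let release_law_setT : release_law P setT = 1.
Proof.
rewrite /release_law (eq_integral (cst 1)); last first.
  move=> x _; rewrite /output_law (_ : [set _ | _] = `[0%R, 1%R]%classic).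
    by rewrite lebesgue_measure_itv/= lte_fin ltr01 sube0.
  by apply/seteqP; split => u /=; [case|].
by rewrite integral_cst// mul1e; exact: probability_setT.
Qed.

HB.instance Definition _ :=
  Measure_isProbability.Build _ _ _ (release_law P) release_law_setT.

End release_law.

(* A reading of the data as a pair, X = (Y, Z), with reference measures on
   the two components. *)
Record coordinates d (X : measurableType d) (R : realType) := {
  dispY : measure_display;
  dispZ : measure_display;
  spaceY : measurableType dispY;
  spaceZ : measurableType dispZ;
  mu1 : {sigma_finite_measure set spaceY -> \bar R};
  mu2 : {sigma_finite_measure set spaceZ -> \bar R};
  pack : spaceY * spaceZ -> X;
  unpack : X -> spaceY * spaceZ;
  packK : cancel pack unpack;
  unpackK : cancel unpack pack;
  measurable_pack : measurable_fun setT pack;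
  measurable_unpack : measurable_fun setT unpack }.

Arguments pack {d X R} c _.
Arguments unpack {d X R} c _.

(* [dens] is the canonical version of the density of (Y, Z); [default] is the
   arbitrary fixed density of Y given {Z = z} when the marginal density of Z
   vanishes at z. *)
Record canonical_density d (X : measurableType d) (R : realType)
    (c : coordinates X R) (P : probability X R) := {
  dens : spaceY c * spaceZ c -> R;
  densP : is_density (mu1 c \x mu2 c) (pushforward P (unpack c)) dens;
  default : spaceY c -> R;
  measurable_default : measurable_fun setT default;
  default_ge0 : forall y, (0 <= default y)%R;
  integral_default : \int[mu1 c]_y (default y)%:E = 1 }.

Section slice_law.
Context d (X : measurableType d) (R : realType).
Variables (c : coordinates X R) (P : probability X R).
Variables (f : canonical_density c P) (z : spaceZ c).

Definition marginal : \bar R := \int[mu1 c]_y (dens f (y, z))%:E.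

(* The marginal density of Z may be infinite on a null set of values z, where
   no normalization is possible; [default] is used there as well. *)
Definition slice_density (y : spaceY c) : R :=
  if 0 < marginal < +oo then (dens f (y, z) / fine marginal)%R
  else default f y.

Definition slice_law (A : set X) : \bar R :=
  \int[mu1 c]_(y in [set y | A (pack c (y, z))]) (slice_density y)%:E.

Let measurable_dens_section : measurable_fun setT (fun y => dens f (y, z)).
Proof.
have [mf _ _] := densP f.
exact: (measurableT_comp mf (pair2_measurable z)).
Qed.

Let dens_ge0 w : (0 <= dens f w)%R.
Proof. by have [_ + _] := densP f; exact. Qed.

Let slice_density_ge0 y : (0 <= slice_density y)%R.
Proof.
rewrite /slice_density; case: ifPn => [/andP[m0 _]|_]; last exact: default_ge0.
by rewrite divr_ge0// fine_ge0// ltW.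
Qed.

Let measurable_slice_density : measurable_fun setT slice_density.
Proof.
rewrite /slice_density; case: (0 < marginal < +oo).
  exact: measurable_funM.
exact: measurable_default.
Qed.

Let integral_slice_density : \int[mu1 c]_y (slice_density y)%:E = 1.
Proof.
rewrite /slice_density; have [/andP[m0 moo]|_] := boolP (0 < marginal < +oo);
  last exact: integral_default.
have mfin : marginal \is a fin_num by rewrite ge0_fin_numE// ltW.
under eq_integral do rewrite EFinM.
rewrite ge0_integralZr//.
- rewrite -/marginal -{1}(fineK mfin) -EFinM mulfV//.
  by rewrite gt_eqF// fine_gt0// m0.
- exact/measurable_EFinP.
- by move=> y _; rewrite lee_fin.
- by rewrite lee_fin invr_ge0 fine_ge0// ltW.
Qed.

Let slice_law0 : slice_law set0 = 0.
Proof. exact: integral_set0. Qed.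

Let slice_law_ge0 A : 0 <= slice_law A.
Proof. by apply: integral_ge0 => y _; rewrite lee_fin. Qed.

Let slice_law_sigma_additive : semi_sigma_additive slice_law.
Proof.
move=> F mF tF mUF; pose G n := [set y | F n (pack c (y, z))].
have mG n : measurable (G n).
  rewrite -[G n]setTI.
  exact: (measurableT_comp (@measurable_pack _ _ _ c) (pair2_measurable z)).
have tG : trivIset setT G.
  apply/trivIsetP => i j _ _ ij; apply/seteqP; split => // y /= [Fi Fj].
  suff: (F i `&` F j) (pack c (y, z)) by move/trivIsetP : tF => ->.
  by split.
rewrite [X in _ --> X](_ : _ = \sum_(n <oo) slice_law (F n)).
  by apply: is_cvg_ereal_nneg_natsum_cond => n _ _; exact: slice_law_ge0.
rewrite /slice_law (_ : [set y | _] = \bigcup_n G n)//.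
rewrite ge0_integral_bigcup//.
- apply/measurable_EFinP; exact: measurable_funTS.
- by move=> y _; rewrite lee_fin.
Qed.

HB.instance Definition _ := isMeasure.Build _ _ _ slice_law
  slice_law0 slice_law_ge0 slice_law_sigma_additive.

Let slice_law_setT : slice_law setT = 1.
Proof. exact: integral_slice_density. Qed.

HB.instance Definition _ :=
  Measure_isProbability.Build _ _ _ slice_law slice_law_setT.

End slice_law.

Record slice_event d (X : measurableType d) (R : realType) (E : set X) := {
  slice_coord : coordinates X R;
  level : spaceZ slice_coord;
  slice_eventE : E = [set x | (unpack slice_coord x).2 = level] }.

(* Conditioning on an event of probability zero depends on choices (the
   coordinates exhibiting it as {Z = z}, the version of the density), which
   are fixed once and for all. *)
Record conditioning d (X : measurableType d) (R : realType)
    (Theta : parametrization X R) := {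
  slice_of : forall E : set X, option (slice_event R E);
  density_of : forall (c : coordinates X R) (theta : Theta),
    option (canonical_density c (law theta)) }.

Section pufferfish.
Context d d' (X : measurableType d) (T : measurableType d') (R : realType).
Variables (Theta : parametrization X R) (C : conditioning Theta).

Definition null_cond_law (theta : Theta) (E : set X) :
    option (probability X R) :=
  if slice_of C E is Some s then
    if density_of C (slice_coord s) theta is Some f then
      Some (slice_law f (level s) : probability X R)
    else None
  else None.

Definition cond_law (theta : Theta) (E : set X) : option (probability X R) :=
  match pselect (measurable E) with
  | left mE =>
      if 0 < law theta E then
        Some (mnormalize (mrestr (law theta) mE) (law theta) : probability X R)
      else null_cond_law theta E
  | right _ => None
  end.

Definition well_defined (theta : Theta) (E : set X) : Prop :=
  cond_law theta E <> None.

(* theta|_E; the value theta is junk when [well_defined theta E] fails. *)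
Definition restrict (theta : Theta) (E : set X) : Theta :=
  if cond_law theta E is Some P then param_of Theta P else theta.

Lemma cond_law_pos (theta : Theta) (E : set X) :
  measurable E -> 0 < law theta E -> well_defined theta E /\
  forall A, measurable A ->
    law (restrict theta E) A = law theta (A `&` E) / law theta E.
Proof.
move=> mE E0; rewrite /well_defined /restrict /cond_law.
case: pselect => // mE'; rewrite E0; split => // A mA.
rewrite law_param_of//= /mnormalize /=.
have -> : mrestr (law theta) mE' setT = law theta E by rewrite /mrestr setTI.
have Efin : law theta E \is a fin_num by exact: fin_num_measure.
have Eoo : law theta E == +oo = false.
  by apply/negbTE; move: Efin; rewrite fin_numE => /andP[].
rewrite Eoo gt_eqF//= /mrestr -[in RHS](fineK Efin) inver.
by rewrite gt_eqF// fine_gt0// E0 ltey Eoo.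
Qed.

Definition edge (D : set Theta) (SS : set (set X * set X))
    (theta theta' : Theta) : Prop :=
  exists theta_star E E',
    [/\ D theta_star, SS (E, E'), well_defined theta_star E,
        well_defined theta_star E' &
        (theta = restrict theta_star E /\ theta' = restrict theta_star E') \/
        (theta' = restrict theta_star E /\ theta = restrict theta_star E')].

Fixpoint walk (e : Theta -> Theta -> Prop) (n : nat) (x y : Theta) : Prop :=
  if n is n'.+1 then exists2 z, e x z & walk e n' z y else x = y.

(* The infimum of the empty set is +oo. *)
Definition graph_dist (D : set Theta) (SS : set (set X * set X))
    (theta theta' : Theta) : \bar R :=
  ereal_inf [set n%:R%:E | n in [set n | walk (edge D SS) n theta theta']].

Definition ratio (x y : \bar R) : \bar R :=
  if (x == 0) && (y == 0) || (x == +oo) && (y == +oo) then 1 else x / y.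

Definition dMult (mu nu : set T -> \bar R) : \bar R :=
  ereal_sup [set `| lne (ratio (mu S) (nu S)) | | S in measurable].

(* Product of [0, +oo] with 0 * +oo = +oo, unlike the library's. *)
Definition mul_budget (x y : \bar R) : \bar R :=
  if (x == +oo) || (y == +oo) then +oo else x * y.

Variable M : mechanism X T R.

(* P(T \in . | theta) and P(T \in . | theta, X \in E) *)
Definition release (theta : Theta) : probability T R :=
  release_law M (law theta).

Definition release_given (theta : Theta) (E : set X) : probability T R :=
  release (restrict theta E).

Definition satisfies (eps : \bar R) (D : set Theta)
    (SS : set (set X * set X)) : Prop :=
  forall theta theta' : Theta,
    dMult (release theta) (release theta')
      <= mul_budget eps (graph_dist D SS theta theta').

End pufferfish.

Definition interval_of_probabilities d (T : measurableType d) (R : realType)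
    (L U : {measure set T -> \bar R}) : set (probability T R) :=
  [set P | forall S, measurable S -> L S <= P S <= U S].

(* Main.v *)
Require Import Defs.
From mathcomp Require Import all_boot all_order all_algebra.
From mathcomp Require Import all_classical all_reals all_analysis.
From mathcomp Require Import measurable_realfun.
Import Order.TTheory GRing.Theory Num.Theory.
Import numFieldNormedType.Exports.
Local Open Scope classical_set_scope.
Local Open Scope ring_scope.
Local Open Scope ereal_scope.

(** Call two laws c-indistinguishable when each is at most e^c times the other
    on every measurable set. For probability measures and c >= 0 this is the
    same as being within multiplicative distance c ([dMult_leP]).

    - (I) implies (II): competing restrictions of an attacker are adjacent in
      the graph, hence at distance at most 1.
    - (II) implies (III): the distance, when finite, is attained by a walk
      ([graph_distP]), and indistinguishability composes along walks, the
      exponents adding up ([walk_indistinguishable]).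
    - (III) implies (IV): a probability Q indistinguishable from P is dominated
      by nu as soon as P is, and so has a Radon-Nikodym density f. The required
      inequalities are to hold everywhere, not only almost everywhere, so f is
      clamped between the multiples e^{-c} p and e^c p of the density p of P;
      it remains a density of Q because P and Q are indistinguishable
      ([is_density_min], [is_density_max], [indistinguishable_density]).
    - (IV) implies (I): take nu to be the law P(T \in . | theta) itself, whose
      density is 1; the density of P(T \in . | theta') lies between e^{-c} and
      e^c, with c the budget times the distance, and integrating it gives
      indistinguishability ([density_indistinguishable]). *)

Set Implicit Arguments.
Unset Strict Implicit.

(** Two-sided multiplicative closeness of set functions, with log-ratio at most
    c. Stated without quotients, so that sets of measure zero need no
    convention. *)
Definition indistinguishable d (T : measurableType d) (R : realType) (c : R)
    (mu nu : set T -> \bar R) : Prop :=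
  forall S, measurable S ->
    mu S <= (expR c)%:E * nu S /\ nu S <= (expR c)%:E * mu S.

Lemma lee_expRNMl (R : realType) (c : R) (x y : \bar R) :
  ((expR (- c))%:E * x <= y) = (x <= (expR c)%:E * y).
Proof. by rewrite expRN muleC lee_pdivrMr ?expR_gt0// muleC. Qed.

Section multiplicative_distance.
Context {R : realType}.

(** When only one of a and b vanishes, the log-ratio is infinite and one of the
    two inequalities on the right fails; when both do, the ratio is 1. *)
Lemma abse_lne_ratio_leP (a b c : R) : (0 <= a)%R -> (0 <= b)%R -> (0 <= c)%R ->
  (`| lne (Defs.ratio a%:E b%:E) | <= c%:E) <->
  (a <= expR c * b)%R /\ (b <= expR c * a)%R.
Proof.
move=> a0 b0 c0; rewrite /Defs.ratio !eqe/= orbF.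
have e0 : (0 < expR c)%R := expR_gt0 c.
have [->|an0] := eqVneq a 0%R; have [->|bn0] := eqVneq b 0%R => /=.
- by rewrite ler10 ln1 abse0 lee_fin mulr0; split.
- have bp : (0 < b)%R by rewrite lt_neqAle eq_sym bn0.
  rewrite mul0e le0_lneNy//= leye_eq; split => // -[_].
  by rewrite mulr0 leNgt bp.
- have ap : (0 < a)%R by rewrite lt_neqAle eq_sym an0.
  rewrite inver eqxx gt0_muley ?lte_fin//= leye_eq; split => // -[].
  by rewrite mulr0 leNgt ap.
have ap : (0 < a)%R by rewrite lt_neqAle eq_sym an0.
have bp : (0 < b)%R by rewrite lt_neqAle eq_sym bn0.
rewrite inver (negbTE bn0) -EFinM lne_EFin ?divr_gt0// lee_fin ler_norml.
rewrite -(ler_expR (- c)%R) -(ler_expR (ln _)) lnK ?posrE ?divr_gt0// expRN.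
rewrite ler_pdivrMr// ler_pdivlMr// mulrC ler_pdivrMr// (mulrC a).
by split => [/andP[]|[-> ->]].
Qed.

Lemma dMult_leP d (T : measurableType d) (P Q : probability T R) (c : R) :
  (0 <= c)%R -> dMult P Q <= c%:E <-> indistinguishable c P Q.
Proof.
move=> c0.
have key S : measurable S ->
    `| lne (Defs.ratio (P S) (Q S)) | <= c%:E <->
    P S <= (expR c)%:E * Q S /\ Q S <= (expR c)%:E * P S.
  move=> mS; rewrite -(fineK (fin_num_measure P S mS)).
  rewrite -(fineK (fin_num_measure Q S mS)) -!EFinM !lee_fin.
  by apply: abse_lne_ratio_leP => //; exact: fine_ge0.
split=> [PQ S mS|PQ].
  by apply/key => //; apply: le_trans PQ; apply: ereal_sup_ubound; exists S.
by apply: ge_ereal_sup => _ [S mS <-]; apply/key => //; exact: PQ.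
Qed.

End multiplicative_distance.

Section shortest_path.
Context d (X : measurableType d) (R : realType).
Variables (Theta : parametrization X R) (C : conditioning Theta).
Variables (D : set Theta) (SS : set (set X * set X)).

Lemma graph_dist_le n theta theta' :
  walk (edge C D SS) n theta theta' ->
  graph_dist C D SS theta theta' <= n%:R%:E.
Proof. by move=> w; apply: ereal_inf_lbound; exists n. Qed.

(** A finite distance is attained by a walk, as natural numbers are
    well-ordered. *)
Lemma graph_distP theta theta' :
  graph_dist C D SS theta theta' = +oo \/
  exists2 n, graph_dist C D SS theta theta' = n%:R%:E &
             walk (edge C D SS) n theta theta'.
Proof.
pose P n := `[< walk (edge C D SS) n theta theta' >].
have [exP|nP] := pselect (exists n, P n); [right|left]; last first.
  apply/eqP; rewrite -leye_eq; apply: le_ereal_inf_tmp => _ [n w <-].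
  by exfalso; apply: nP; exists n; apply/asboolP.
case: (ex_minnP exP) => n /asboolP w nmin; exists n => //.
apply/eqP; rewrite eq_le graph_dist_le//=.
apply: le_ereal_inf_tmp => _ [m w' <-].
by rewrite lee_fin ler_nat; apply: nmin; apply/asboolP.
Qed.

End shortest_path.

Arguments graph_distP {d X R Theta} C D SS theta theta'.

Section density.
Context d (T : measurableType d) (R : realType).
Variable nu : {measure set T -> \bar R}.

(** To replace a density p by another function q, it suffices to compare
    integrals over the measurable subsets of {p <> q}. *)
Lemma is_density_eq (P : set T -> \bar R) (p q : T -> R) :
  is_density nu P p -> measurable_fun setT q -> (forall t, (0 <= q t)%R) ->
  (forall S, measurable S -> S `<=` [set t | p t != q t] ->
     \int[nu]_(t in S) (p t)%:E = \int[nu]_(t in S) (q t)%:E) ->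
  is_density nu P q.
Proof.
move=> [mp p0 pE] mq q0 pq; split => // S mS; rewrite pE//.
pose N := [set t | p t != q t].
have mN : measurable N.
  rewrite -[N]setTI (_ : N = (fun t => p t == q t) @^-1` [set false]).
    exact: measurable_fun_eqr.
  by apply/seteqP; split => t /=; [move/negbTE|move/negbT].
have split_int (f : T -> R) : measurable_fun setT f -> (forall t, (0 <= f t)%R) ->
    \int[nu]_(t in S) (f t)%:E =
    \int[nu]_(t in S `&` N) (f t)%:E + \int[nu]_(t in S `\` N) (f t)%:E.
  move=> mf f0; rewrite -ge0_integral_setU ?setUIDK//.
  - exact: measurableI.
  - exact: measurableD.
  - by apply/measurable_EFinP; exact: measurable_funTS.
  - by move=> t _; rewrite lee_fin.
  - by apply/disj_set2P; rewrite setDE setIACA setICr setI0.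
rewrite !split_int//; congr (_ + _).
  by apply: pq; [exact: measurableI|exact: subIsetr].
apply: eq_integral => t; rewrite inE => -[_] /negP; rewrite negbK.
by move=> /eqP ->.
Qed.

(** If P lies below the measure with density b, then any density of P can be
    capped by b: where b < p, the inequalities
    P S <= \int_S b <= \int_S p = P S are equalities. *)
Lemma is_density_min (P : set T -> \bar R) (p b : T -> R) :
  is_density nu P p -> measurable_fun setT b -> (forall t, (0 <= b t)%R) ->
  (forall S, measurable S -> P S <= \int[nu]_(t in S) (b t)%:E) ->
  is_density nu P (fun t => Num.min (p t) (b t)).
Proof.
move=> dp mb b0 Pb; have [mp p0 pE] := dp.
apply: (is_density_eq dp).
- exact: measurable_minr.
- by move=> t; rewrite le_min p0 b0.
move=> S mS SN; apply/eqP; rewrite eq_le; apply/andP; split.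
- rewrite -pE// (le_trans (Pb S mS))// le_eqVlt; apply/orP; left; apply/eqP.
  apply: eq_integral => t; rewrite inE => /SN /=; rewrite minEle.
  by case: ifPn => //; rewrite eqxx.
- apply: ge0_le_integral => //.
  + by move=> t _; rewrite lee_fin le_min p0 b0.
  + by apply/measurable_EFinP/measurable_funTS; exact: measurable_minr.
  + by apply/measurable_EFinP; exact: measurable_funTS.
  + by move=> t _; rewrite lee_fin ge_min lexx.
Qed.

(** Dual to [is_density_min], on the set where p < b. *)
Lemma is_density_max (P : set T -> \bar R) (p b : T -> R) :
  is_density nu P p -> measurable_fun setT b -> (forall t, (0 <= b t)%R) ->
  (forall S, measurable S -> \int[nu]_(t in S) (b t)%:E <= P S) ->
  is_density nu P (fun t => Num.max (p t) (b t)).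
Proof.
move=> dp mb b0 bP; have [mp p0 pE] := dp.
apply: (is_density_eq dp).
- exact: measurable_maxr.
- by move=> t; rewrite le_max p0.
move=> S mS SN; apply/eqP; rewrite eq_le; apply/andP; split.
- apply: ge0_le_integral => //.
  + by move=> t _; rewrite lee_fin.
  + by apply/measurable_EFinP; exact: measurable_funTS.
  + by apply/measurable_EFinP/measurable_funTS; exact: measurable_maxr.
  + by move=> t _; rewrite lee_fin le_max lexx.
- rewrite -pE// (le_trans _ (bP S mS))// le_eqVlt; apply/orP; left; apply/eqP.
  apply: eq_integral => t; rewrite inE => /SN /=; rewrite maxEle.
  by case: ifPn => //; rewrite eqxx.
Qed.

End density.

(** Radon-Nikodym, with a finite-valued and everywhere nonnegative density. *)
Lemma dominates_density d (T : measurableType d) (R : realType)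
    (nu : {sigma_finite_measure set T -> \bar R})
    (P : {finite_measure set T -> \bar R}) :
  P `<< nu -> exists p : T -> R, is_density nu P p.
Proof.
move=> /radon_nikodym_sigma_finite[f [f0 ffin fi fE]].
exists (fine \o f); split.
- by apply/measurable_EFinP; have /integrableP[mf _] := fi;
    apply: eq_measurable_fun mf => t _ /=; rewrite fineK.
- by move=> t; rewrite fine_ge0.
- by move=> S mS; rewrite fE//; apply: eq_integral => t _ /=; rewrite fineK.
Qed.

(** The bounds on the density of Q hold at every point. *)
Lemma indistinguishable_density d (T : measurableType d) (R : realType)
    (nu : {sigma_finite_measure set T -> \bar R}) (P Q : probability T R)
    (c : R) (p : T -> R) :
  (0 <= c)%R -> indistinguishable c P Q -> is_density nu P p ->
  exists2 q : T -> R, is_density nu Q q &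
    forall t, (expR (- c) * p t <= q t <= expR c * p t)%R.
Proof.
move=> c0 PQ [mp p0 pE].
have scaleE (r : R) S : (0 <= r)%R -> measurable S ->
    \int[nu]_(t in S) (r * p t)%:E = r%:E * P S.
  move=> r0 mS; rewrite pE// -ge0_integralZl//.
  - by apply/measurable_EFinP; exact: measurable_funTS.
  - by move=> t _; rewrite lee_fin.
have PQu S : measurable S -> Q S <= (expR c)%:E * P S by move=> /PQ[].
have PQl S : measurable S -> (expR (- c))%:E * P S <= Q S.
  by move=> /PQ[PQS _]; rewrite lee_expRNMl.
have Qnu : Q `<< nu.
  apply/null_content_dominatesP => S mS nuS0; apply/eqP.
  rewrite eq_le measure_ge0 andbT (le_trans (PQu S mS))// pE//.
  by rewrite null_set_integral ?mule0//;
    apply/measurable_EFinP; exact: measurable_funTS.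
have [f df] := dominates_density Qnu.
have mscale (r : R) : measurable_fun setT (fun t => r * p t)%R.
  exact: measurable_funM.
have df1 := is_density_min df (mscale (expR c)).
have df2 := is_density_max (df1 _ _) (mscale (expR (- c))).
(* As e^{-c} p <= e^c p, taking the maximum last preserves the upper bound. *)
exists (fun t => Num.max (Num.min (f t) (expR c * p t)) (expR (- c) * p t))%R.
  apply: df2 => [t|S mS|t|S mS].
  - by rewrite mulr_ge0// expR_ge0.
  - by rewrite scaleE ?expR_ge0//; exact: PQu.
  - by rewrite mulr_ge0// expR_ge0.
  - by rewrite scaleE ?expR_ge0//; exact: PQl.
move=> t; rewrite le_max lexx orbT/= ge_max ge_min lexx orbT/=.
by apply: ler_wpM2r => //; rewrite ler_expR ge0_cp.
Qed.

(** Here the reference measure is P itself, of which the constant 1 is the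
    density. *)
Lemma density_indistinguishable d (T : measurableType d) (R : realType)
    (P Q : probability T R) (c : R) (q : T -> R) :
  is_density P Q q -> (forall t, (expR (- c) <= q t <= expR c)%R) ->
  indistinguishable c P Q.
Proof.
move=> [mq q0 qE] qc S mS.
have mqS : measurable_fun S (EFin \o q).
  by apply/measurable_EFinP; exact: measurable_funTS.
have lo : (expR (- c))%:E * P S <= Q S.
  rewrite qE// -integral_cst//; apply: ge0_le_integral => //.
  - by move=> t _; rewrite lee_fin expR_ge0.
  - by move=> t _; rewrite lee_fin; have /andP[] := qc t.
split; first by rewrite -lee_expRNMl.
rewrite qE// -integral_cst//; apply: ge0_le_integral => //.
- by move=> t _; rewrite lee_fin.
- by move=> t _; rewrite lee_fin; have /andP[] := qc t.
Qed.

Lemma indistinguishable_refl d (T : measurableType d) (R : realType)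
    (mu : set T -> \bar R) : indistinguishable 0 mu mu.
Proof. by move=> S mS; rewrite expR0 mul1e. Qed.

Lemma indistinguishable_trans d (T : measurableType d) (R : realType) (b c : R)
    (mu nu rho : set T -> \bar R) :
  indistinguishable b mu nu -> indistinguishable c nu rho ->
  indistinguishable (b + c) mu rho.
Proof.
move=> mn nr S mS; have [mnS nmS] := mn S mS; have [nrS rnS] := nr S mS.
rewrite expRD; split.
- rewrite EFinM -muleA (le_trans mnS)//.
  by apply: lee_wpmul2l; rewrite ?lee_fin ?expR_ge0.
- rewrite mulrC EFinM -muleA (le_trans rnS)//.
  by apply: lee_wpmul2l; rewrite ?lee_fin ?expR_ge0.
Qed.

Section group_privacy.
Context d d' (X : measurableType d) (T : measurableType d') (R : realType).
Variables (Theta : parametrization X R) (C : conditioning Theta).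
Variables (M : mechanism X T R) (D : set Theta) (SS : set (set X * set X)).

(** Group privacy: a bound on edges multiplies by the length along walks. *)
Lemma walk_indistinguishable (c : R) n theta theta' :
  (forall t t', edge C D SS t t' ->
     indistinguishable c (release M t) (release M t')) ->
  walk (edge C D SS) n theta theta' ->
  indistinguishable (n%:R * c)%R (release M theta) (release M theta').
Proof.
move=> edgeP; elim: n theta => [|n IHn] theta /= => [->|[z tz zt']].
  by rewrite mul0r; exact: indistinguishable_refl.
rewrite -nat1r mulrDl mul1r.
exact: indistinguishable_trans (edgeP _ _ tz) (IHn _ zt').
Qed.

End group_privacy.

Unset Implicit Arguments.

Theorem theorem20 (R : realType) (d d' : measure_display)
    (X : measurableType d) (T : measurableType d')
    (Theta : parametrization X R) (C : conditioning Theta)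
    (G : Theta -> R -> X)
    (mG : forall theta, measurable_fun (`[0%R, 1%R] : set R) (G theta))
    (GE : forall theta E, measurable E ->
      law theta E = lebesgue_measure [set u : R | `[0%R, 1%R]%classic u /\ E (G theta u)])
    (M : mechanism X T R)
    (eps : R) (eps_ge0 : (0 <= eps)%R)
    (D : set Theta) (SS : set (set X * set X))
    (mSS : forall E E', SS (E, E') -> measurable E /\ measurable E') :
  [<-> (* (I) *)
    satisfies C M eps%:E D SS;
    (* (II) *)
    forall S, measurable S -> forall E E', SS (E, E') ->
      forall theta_star, D theta_star ->
      well_defined C theta_star E -> well_defined C theta_star E' ->
      release_given C M theta_star E S
        <= (expR eps)%:E * release_given C M theta_star E' S /\
      release_given C M theta_star E' S
        <= (expR eps)%:E * release_given C M theta_star E S;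
    (* (III) *)
    forall (delta : nat) (theta theta' : Theta),
      graph_dist C D SS theta theta' = delta%:R%:E ->
      interval_of_probabilities
        (mscale (NngNum (expR_ge0 (- (delta%:R * eps))%R)) (release M theta))
        (mscale (NngNum (expR_ge0 (delta%:R * eps)%R)) (release M theta))
        (release M theta');
    (* (IV) *)
    forall (theta : Theta) (nu : {sigma_finite_measure set T -> \bar R})
      (p : T -> R), is_density nu (release M theta) p ->
      forall theta' : Theta, graph_dist C D SS theta theta' < +oo ->
      exists2 p' : T -> R, is_density nu (release M theta') p' &
        forall t,
          (expR (- (eps * fine (graph_dist C D SS theta theta'))) * p t
             <= p' t
             <= expR (eps * fine (graph_dist C D SS theta theta')) * p t)%R].
Proof.
tfae.
- move=> sat S mS E E' EE' theta Dt wE wE'.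
  have e1 : edge C D SS (Defs.restrict C theta E) (Defs.restrict C theta E').
    by exists theta, E, E'; split => //; left.
  suff: indistinguishable eps (release_given C M theta E) (release_given C M theta E').
    exact.
  apply/dMult_leP => //; apply: (le_trans (sat _ _)).
  have w1 : walk (edge C D SS) 1 (Defs.restrict C theta E) (Defs.restrict C theta E').
    by exists (Defs.restrict C theta E').
  have := graph_dist_le w1.
  have [->|[n -> _]] := graph_distP C D SS (Defs.restrict C theta E) (Defs.restrict C theta E').
    by rewrite leye_eq.
  (* The two restrictions may coincide, so the distance n is 0 or 1. *)
  by rewrite /mul_budget/= -EFinM !lee_fin => n1; rewrite ler_piMr.
- move=> II delta theta theta' dist.
  have edgeP t t' : edge C D SS t t' ->
      indistinguishable eps (release M t) (release M t').
    move=> [ts [E [E' [Dt EE' wE wE' [[-> ->]|[-> ->]]]]]] S mS.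
      exact: (II S mS E E' EE' ts Dt wE wE').
    by have [] := II S mS E E' EE' ts Dt wE wE'; split.
  have [|[n]] := graph_distP C D SS theta theta'; rewrite dist// => -[/eqP].
  rewrite eqr_nat => /eqP -> w S mS /=.
  have [lo up] := walk_indistinguishable edgeP w mS.
  by rewrite /mscale/= lee_expRNMl lo.
- move=> III theta nu p dp theta' fin.
  have [doo|[n dn _]] := graph_distP C D SS theta theta'.
    by rewrite doo ltxx in fin.
  rewrite dn/= (mulrC eps); apply: indistinguishable_density dp.
    by rewrite mulr_ge0.
  move=> S mS; have /andP[lo up] := III n theta theta' dn S mS.
  by split; [rewrite -lee_expRNMl; exact: lo|exact: up].
- move=> IV theta theta'.
  have [->|[n dn _]] := graph_distP C D SS theta theta'.
    by rewrite /mul_budget orbT leey.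
  have one : is_density (release M theta) (release M theta) (fun=> 1%R).
    by split => // S mS; rewrite integral_cst// mul1e.
  have [|q dq qP] := IV theta _ _ one theta'; first by rewrite dn ltry.
  rewrite dn /mul_budget/= -EFinM; apply/dMult_leP; first by rewrite mulr_ge0.
  apply: density_indistinguishable dq _ => t.
  by have := qP t; rewrite dn/= !mulr1.
Qed.
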